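(* Let $n$ be a positive integer. Define the polynomial $$ p_n(y) = \prod_{k=1}^{n}\frac{4^k y-1}{4^k-1} = A_0 + A_1 y + \cdots + A_n y^n, $$ and the function on $(0,\pi/2]$ $$ g_n(\theta) = \theta \sum_{k=0}^{n} \frac{A_k}{2^k}\,\cot\!\left(\frac{\theta}{2^k}\right), $$ extended to $\theta=0$ by $g_n(0)=\lim_{\theta\to 0^+}g_n(\theta)=1$. For $j\ge 0$ let $e_j(y_1,\ldots,y_n)$ denote the $j$-th elementary symmetric polynomial in $n$ variables (with $e_0=1$). Define functions $L_j$ on $\mathbb{R}$ by $$ L_0(x)=1, \qquad L_{j+1}(x) = L_j(x) + \sqrt{x^2+L_j(x)^2}, $$ and, for $x>0$, $$ a_n(x) = \frac{x\cdot\prod_{k=1}^{n}(4^k-1)}{\displaystyle\sum_{j=0}^n (-1)^{n-j}\, L_j(x)\, 2^j\, e_j(1,4,4^2,\ldots,4^{n-1})}. $$ Let $K_{low}=\min(g_n(0),g_n(\pi/2))$ and $K_{high}=\max(g_n(0),g_n(\pi/2))$. Then for every real $x>0$, $$ K_{low}\cdot a_n(x) < \arctan x < K_{high}\cdot a_n(x), $$ and moreover $K_{high}-K_{low} < 4^{-n}$. *)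

(* Defs.v *)
From HB Require Import structures.
From mathcomp Require Import all_boot all_order all_algebra.
From mathcomp Require Import all_classical all_reals all_analysis.
(* Required but not imported: the notations of mpoly clash with those of
   MathComp-Analysis. *)
From mathcomp Require mpoly.

Set Implicit Arguments.
Unset Strict Implicit.
Unset Printing Implicit Defensive.

Import Order.TTheory GRing.Theory Num.Theory.
Import numFieldNormedType.Exports.

Local Open Scope classical_set_scope.
Local Open Scope ring_scope.

Section Defs.
Variable R : realType.

Definition cot (t : R) : R := cos t / sin t.

Definition p_poly (n : nat) : {poly R} :=
  \prod_(1 <= k < n.+1) ((4 ^+ k - 1)^-1 *: (4 ^+ k *: 'X - 1)).

Definition A_coef (n k : nat) : R := (p_poly n)`_k.

Definition g_formula (n : nat) (t : R) : R :=
  t * \sum_(0 <= k < n.+1) (A_coef n k / 2 ^+ k * cot (t / 2 ^+ k)).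

(* Only the values on [0, pi/2] are meaningful. *)
Definition g_fun (n : nat) (t : R) : R :=
  if t == 0 then lim (g_formula n s @[s --> 0^'+]) else g_formula n t.

Definition elem_sym (n j : nat) (y : 'I_n -> R) : R :=
  mpoly.meval y (mpoly.mesym n R j).

Fixpoint L_fun (j : nat) (x : R) : R :=
  if j is i.+1 then L_fun i x + Num.sqrt (x ^+ 2 + L_fun i x ^+ 2) else 1.

Definition a_fun (n : nat) (x : R) : R :=
  x * (\prod_(1 <= k < n.+1) (4 ^+ k - 1)) /
  \sum_(0 <= j < n.+1)
    ((-1) ^+ (n - j) * L_fun j x * 2 ^+ j *
     elem_sym j (fun i : 'I_n => 4 ^+ i)).

Definition K_low (n : nat) : R := Num.min (g_fun n 0) (g_fun n (pi / 2)).

Definition K_high (n : nat) : R := Num.max (g_fun n 0) (g_fun n (pi / 2)).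

End Defs.

(* Main.v *)
Require Import Defs.
From HB Require Import structures.
From mathcomp Require Import all_boot all_order all_algebra.
From mathcomp Require Import all_classical all_reals all_analysis.
From mathcomp Require mpoly.
(* The ring-morphism structure of [meval], without the clashing notations. *)
Import (canonicals) mpoly.
From mathcomp Require Import ring lra.

Import Order.TTheory GRing.Theory Num.Theory.
Import numFieldNormedType.Exports.

Local Open Scope classical_set_scope.
Local Open Scope ring_scope.

(** With [t = atan x] one has [L_j x = x * cot (t / 2^j)], and the coefficients
    of [p_n] are elementary symmetric functions, so [a_n x = t / g_n t]: the
    bounds say that [g_n] is strictly monotone on [0, pi/2].

    Write [t * cot t = 1 - sum_m a_m t^(2m)].  The function
    [v s = 1 - sqrt s * cot (sqrt s)] solves [2 s v' + v = s + v^2], which gives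
    a recursion for [a_m] showing [0 < a_m <= 2 / 6^m]; conversely the truncated
    series satisfy this equation up to a geometrically small residual, and a
    Gronwall estimate shows that they converge to [1 - t * cot t] on
    [0 < t <= pi/2].

    Summing against the coefficients of [p_n] yields
    [g_n t = p_n 1 - sum_m a_m p_n(4^-m) t^(2m)], where [p_n 1 = 1],
    [p_n(4^-m) = 0] for [1 <= m <= n], and [(-1)^n p_n(4^-m)] lies between [0]
    and [D = prod_k (4^k - 1)^-1] for [m > n].  Hence [(-1)^n (1 - g_n)] is
    strictly increasing.  As [sum_m a_m (pi/2)^(2m) = 1] and [a_1 = 1/3], its
    value at [pi/2] is at most [D (1 - (pi/2)^2 / 3) <= 2 D / 3 < 4^-n]. *)

(** * Bounds on polynomial values from bounds on coefficients *)

Section HornerBounds.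
Variable R : realFieldType.
Implicit Types (p q : {poly R}) (x r C : R).

Lemma le_horner p q x : 0 <= x -> (forall k, p`_k <= q`_k) -> p.[x] <= q.[x].
Proof.
move=> x0 pq; pose n := maxn (size p) (size q).
rewrite (horner_coef_wide _ (leq_maxl _ _ : size p <= n)%N).
rewrite (horner_coef_wide _ (leq_maxr _ _ : size q <= n)%N).
by apply: ler_sum => k _; rewrite ler_wpM2r ?exprn_ge0.
Qed.

(** The [maxn] covers the empty sum: for [n <= N.+1] the two powers on the right cancel. *)
Lemma sum_geometric_tail r (N n : nat) :
  (1 - r) * (\sum_(k < n | (N < k)%N) r ^+ k) = r ^+ N.+1 - r ^+ maxn n N.+1.
Proof.
elim: n => [|n IH]; first by rewrite big_ord0 mulr0 max0n subrr.
rewrite big_mkcond big_ord_recr -big_mkcond /= mulrDr IH.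
case: ltnP => Nn.
  by rewrite (maxn_idPl Nn) (maxn_idPl (leqW Nn)) !exprS; ring.
by rewrite mulr0 addr0 (maxn_idPr (leqW Nn)) (maxn_idPr (Nn : n.+1 <= N.+1)%N).
Qed.

Lemma horner_le_geometric p x r C (N : nat) :
  0 <= r < 1 -> 0 <= C ->
  (forall k, (k <= N)%N -> p`_k * x ^+ k <= 0) ->
  (forall k, (N < k)%N -> p`_k * x ^+ k <= C * r ^+ k) ->
  p.[x] <= C * (r ^+ N.+1 / (1 - r)).
Proof.
move=> /andP[r0 r1] C0 hle hgt.
have q0 : 0 < 1 - r by rewrite subr_gt0.
apply: (@le_trans _ _ (C * \sum_(k < size p | (N < k)%N) r ^+ k)).
  rewrite horner_coef mulr_sumr big_mkcond [leRHS]big_mkcond /=.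
  by apply: ler_sum => k _; case: ltnP => [/hgt|/hle].
rewrite ler_wpM2l// ler_pdivlMr// mulrC sum_geometric_tail.
by rewrite lerBlDr lerDl exprn_ge0.
Qed.

End HornerBounds.

(** * Series coefficients of 1 - sqrt s * cot (sqrt s) and the Riccati residual *)

Section CotSeries.
Variable R : realFieldType.

(** Comparing coefficients of s^(M+1) in 2 s v' + v = s + v^2 gives the factor 2 (M+1) + 1. As v has
    no constant term, v^2 contributes only earlier coefficients, so carrying the whole truncation
    makes the recursion structural. *)
Fixpoint cot_poly (N : nat) : {poly R} :=
  if N is M.+1 then
    cot_poly M +
    ((2 * M + 3)%:R^-1 * ('X + cot_poly M ^+ 2)`_M.+1) *: 'X^(M.+1)
  else 0.

Definition cot_coef (k : nat) : R := (cot_poly k)`_k.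

Lemma size_cot_poly N : (size (cot_poly N) <= N.+1)%N.
Proof.
elim: N => [|N IH] /=; first by rewrite size_poly0.
rewrite (leq_trans (size_polyD _ _))// geq_max (leq_trans IH)//=.
by rewrite (leq_trans (size_scale_leq _ _))// size_polyXn.
Qed.

Lemma coef_cot_poly N k :
  (cot_poly N)`_k = if (k <= N)%N then cot_coef k else 0.
Proof.
case: leqP => [|Nk]; last by rewrite nth_default// (leq_trans (size_cot_poly N)).
elim: N => [|N IH]; first by rewrite leqn0 => /eqP ->.
rewrite leq_eqVlt => /predU1P[-> //|kN] /=.
by rewrite coefD coefZ coefXn ltn_eqF// mulr0 addr0 IH.
Qed.

Lemma cot_coef0 : cot_coef 0 = 0.
Proof. by rewrite /cot_coef coef0. Qed.

Lemma cot_coef_rec k : (2 * k + 3)%:R * cot_coef k.+1 =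
  (k == 0)%:R + \sum_(i < k) cot_coef i.+1 * cot_coef (k - i).
Proof.
rewrite {1}/cot_coef /= coefD coefZ coefXn eqxx mulr1.
rewrite (coef_cot_poly k k.+1) ltnn add0r mulrA divff; last first.
  by rewrite pnatr_eq0 addn3.
rewrite mul1r coefD coefX eqSS expr2 coefM big_ord_recl big_ord_recr /=.
rewrite coef_cot_poly /= cot_coef0 mul0r add0r.
rewrite subnn [X in _ * X]coef_cot_poly/= cot_coef0 mulr0 addr0.
congr (_ + _); apply: eq_bigr => i _.
by rewrite /bump/= add1n subSS !coef_cot_poly ltn_ord leq_subr.
Qed.

(** Strong induction: the convolution has [k] products, each at most 4 / 6^(k+1), and 4k / (2k+3) <=
    2. The source term enters only at [k = 0], where 1/3 = 2/6 attains the bound. *)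
Lemma cot_coef_ge0_le k : 0 <= cot_coef k <= 2 / 6 ^+ k.
Proof.
have [n] := ubnP k; elim: n k => // n IH [_|k kn].
  by rewrite cot_coef0 expr0 divr1 lexx ler0n.
have p3 : 0 < (2 * k + 3)%:R :> R by rewrite ltr0n addn3.
have b (i : 'I_k) : 0 <= cot_coef i.+1 * cot_coef (k - i) <= 4 / 6 ^+ k.+1.
  have /andP[u0 u1] : 0 <= cot_coef i.+1 <= 2 / 6 ^+ i.+1.
    exact/IH/(leq_ltn_trans (ltn_ord i)).
  have /andP[v0 v1] : 0 <= cot_coef (k - i) <= 2 / 6 ^+ (k - i).
    exact/IH/(leq_ltn_trans (leq_subr _ _)).
  rewrite mulr_ge0//= (le_trans (ler_pM u0 v0 u1 v1))//.
  by rewrite mulrACA -invfM -exprD addSn subnKC 1?ltnW//; lra.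
have := cot_coef_rec k; rewrite mulrC => /(canRL (mulfK (lt0r_neq0 p3))) ->.
rewrite divr_ge0 ?ler0n ?addr_ge0 ?sumr_ge0//=; last first.
  by move=> i _; case/andP: (b i).
rewrite ler_pdivrMr//.
have : \sum_(i < k) cot_coef i.+1 * cot_coef (k - i) <= k%:R * (4 / 6 ^+ k.+1).
  rewrite mulr_natl -[k in _ *+ k]card_ord -sumr_const.
  by apply: ler_sum => i _; case/andP: (b i).
case: k {b IH kn p3} => [|k] /=; first by rewrite mul0r muln0 expr1; lra.
rewrite add0r => /le_trans; apply.
rewrite natrD natrM.
have : 0 < 6 ^- k.+2 :> R by rewrite invr_gt0 exprn_gt0.
have : 0 <= k.+1%:R :> R by [].
move: (6 ^- _) => x; move: (k.+1%:R) => y y0 x0; nra.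
Qed.

Lemma cot_coef_ge0 k : 0 <= cot_coef k.
Proof. by case/andP: (cot_coef_ge0_le k). Qed.

Lemma cot_coef_le k : cot_coef k <= 2 / 6 ^+ k.
Proof. by case/andP: (cot_coef_ge0_le k). Qed.

Lemma cot_coef1 : cot_coef 1 = 3^-1.
Proof.
have := cot_coef_rec 0; rewrite big_ord0 /= muln0 add0n addr0 => h.
by apply: (mulfI (_ : 3 != 0)); rewrite ?h ?mulfV ?pnatr_eq0.
Qed.

Lemma cot_coef_gt0 k : 0 < cot_coef k.+1.
Proof.
elim: k => [|k IH]; first by rewrite cot_coef1 invr_gt0.
have p3 : 0 < (2 * k.+1 + 3)%:R :> R by rewrite ltr0n addn3.
rewrite -(pmulr_rgt0 _ p3) cot_coef_rec add0r big_ord_recl /= subn0 cot_coef1.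
rewrite ltr_pwDl ?mulr_gt0 ?invr_gt0// sumr_ge0// => i _.
by rewrite mulr_ge0 ?cot_coef_ge0.
Qed.

Lemma horner_cot_poly N (s : R) :
  (cot_poly N).[s] = \sum_(k < N.+1) cot_coef k * s ^+ k.
Proof.
rewrite (horner_coef_wide _ (size_cot_poly N)); apply: eq_bigr => i _.
by rewrite coef_cot_poly -ltnS ltn_ord.
Qed.

Lemma horner_cot_poly_ge0 N (s : R) : 0 <= s -> 0 <= (cot_poly N).[s].
Proof.
move=> s0; rewrite horner_cot_poly sumr_ge0// => i _.
by rewrite mulr_ge0 ?exprn_ge0 ?cot_coef_ge0.
Qed.

(** The coefficient bound gives 2 * sum_(k >= 1) (s/6)^k = 2 s / (6 - s), which is at most s because
    s <= 4. *)
Lemma horner_cot_poly_le N (s : R) : 0 <= s <= 4 -> (cot_poly N).[s] <= s.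
Proof.
move=> /andP[s0 s4].
have r1 : 0 <= s / 6 < 1 by lra.
apply: (@le_trans _ _ (2 * ((s / 6) ^+ 1 / (1 - s / 6)))).
  apply: horner_le_geometric => // k.
    by rewrite leqn0 => /eqP ->; rewrite coef_cot_poly cot_coef0 mul0r.
  move=> _; rewrite coef_cot_poly; case: ifP => _; last first.
    by rewrite mul0r mulr_ge0// exprn_ge0//; lra.
  rewrite expr_div_n mulrCA mulrC ler_wpM2l ?exprn_ge0//; exact: cot_coef_le.
have d : 0 < 1 - s / 6 by lra.
by rewrite expr1 mulrA ler_pdivrMr//; nra.
Qed.

(* Residual of the truncated series in the Riccati equation
   2 s v' + v = s + v^2 satisfied by v(s) = 1 - sqrt s * cot (sqrt s). *)
Definition cot_residual N : {poly R} :=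
  cot_poly N ^+ 2 + 'X - cot_poly N - 2 *: ('X * (cot_poly N)^`()).

(** The recursion cancels every degree up to [N]; above [N] the linear terms vanish by truncation
    and only the square remains. *)
Lemma coef_cot_residual N k : (0 < N)%N ->
  (cot_residual N)`_k = if (k <= N)%N then 0 else (cot_poly N ^+ 2)`_k.
Proof.
move=> N0; rewrite /cot_residual !coefB coefD coefZ coefX.
case: k => [|k].
  rewrite coefXM /= mulr0 subr0 addr0 expr2 coefM big_ord1 /=.
  by rewrite coef_cot_poly /= cot_coef0 mulr0 subr0.
rewrite coefXM /= coef_deriv eqSS coef_cot_poly.
case: ltnP => kN; last first.
  by rewrite mul0rn mulr0 !subr0 (gtn_eqF (leq_trans N0 kN)) addr0.
have -> : (cot_poly N ^+ 2)`_k.+1 =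
    \sum_(i < k) cot_coef i.+1 * cot_coef (k - i).
  rewrite expr2 coefM big_ord_recl big_ord_recr /=.
  rewrite coef_cot_poly /= cot_coef0 mul0r add0r.
  rewrite subnn [X in _ + _ * X]coef_cot_poly/= cot_coef0 mulr0 addr0.
  apply: eq_bigr => i _; rewrite /bump/= add1n subSS !coef_cot_poly.
  rewrite (leq_trans (ltn_ord i)) 1?ltnW//.
  exact: leq_ltn_trans (leq_subr _ _) kN.
rewrite [X in X - _ - _]addrC -cot_coef_rec natrD natrM -mulr_natr.
by rewrite -natr1; ring.
Qed.

Lemma cot_residual_ge0 N (s : R) : (0 < N)%N -> 0 <= s -> 0 <= (cot_residual N).[s].
Proof.
move=> N0 s0; rewrite -(horner0 s); apply: le_horner => // k.
rewrite coef0 coef_cot_residual//; case: ifP => // _.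
rewrite expr2 coefM sumr_ge0// => i _.
by rewrite !coef_cot_poly; do 2?case: ifP; rewrite ?mulr_ge0 ?cot_coef_ge0.
Qed.

(** The k-th coefficient of the square is at most 4 (k+1) / 6^k. Trading k+1 for 5 (6/5)^k and
    multiplying by 4^k leaves 20 (4/5)^k, whose tail past [N] sums to 80 (4/5)^N. *)
Lemma cot_residual_le N (s : R) : (0 < N)%N -> 0 <= s <= 4 ->
  (cot_residual N).[s] <= 100 * (4 / 5) ^+ N.
Proof.
move=> N0 /andP[s0 s4].
apply: (@le_trans _ _ (20 * ((4 / 5) ^+ N.+1 / (1 - 4 / 5)))); last first.
  rewrite exprS (_ : 1 - 4 / 5 = 5^-1 :> R) ?invrK; last by lra.
  have : 0 <= (4 / 5) ^+ N :> R by rewrite exprn_ge0.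
  by move: (_ ^+ N) => y; lra.
have r1 : 0 <= (4 / 5 : R) < 1 by lra.
apply: horner_le_geometric => // k kN; rewrite coef_cot_residual//.
  by rewrite kN mul0r.
rewrite leqNgt kN /=.
have b : (cot_poly N ^+ 2)`_k <= k.+1%:R * (4 / 6 ^+ k).
  rewrite expr2 coefM mulr_natl -[X in _ *+ X]card_ord -sumr_const.
  apply: ler_sum => i _.
  rewrite (_ : 4 / 6 ^+ k = (2 / 6 ^+ i) * (2 / 6 ^+ (k - i))); last first.
    by rewrite mulrACA -invfM -exprD subnKC 1?leq_ord//; lra.
  have e0 (j : nat) : 0 <= (cot_poly N)`_j <= 2 / 6 ^+ j.
    rewrite coef_cot_poly; case: ifP => _; first exact: cot_coef_ge0_le.
    by rewrite lexx divr_ge0.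
  have /andP[u0 u1] := e0 i; have /andP[v0 v1] := e0 (k - i)%N.
  exact: ler_pM.
have bern : k.+1%:R <= 5 * (6 / 5) ^+ k :> R.
  elim: k {kN b} => [|k IH]; first by rewrite expr0; lra.
  rewrite exprS -natr1; have : 1 <= k.+1%:R :> R by rewrite ler1n.
  have : 1 <= (6 / 5) ^+ k :> R by rewrite exprn_ege1//; lra.
  by move: (_ ^+ k) IH => y IH; lra.
apply: (le_trans (ler_wpM2r (exprn_ge0 _ s0) b)).
apply: (@le_trans _ _ (5 * (6 / 5) ^+ k * (4 / 6 ^+ k) * 4 ^+ k)).
  apply: ler_pM; rewrite ?exprn_ge0 ?mulr_ge0 ?divr_ge0 ?exprn_ge0//.
    by rewrite ler_wpM2r// divr_ge0.
  by rewrite lerXn2r ?nnegrE.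
rewrite (_ : 4 / 5 = 6 / 5 * (6^-1 * 4) :> R); last by lra.
rewrite !exprMn !exprVn le_eqVlt; apply/orP; left; apply/eqP.
by ring.
Qed.

End CotSeries.

(** * Convergence of the truncated series by a Gronwall estimate *)

Section CotLimit.
Variable R : realType.
Implicit Types (N : nat) (t s : R).

(** The truncation error multiplied by sin t, which avoids the division at 0 and makes the defect
    vanish there. *)
Definition cot_defect N t : R :=
  (1 - (cot_poly R N).[t ^+ 2]) * sin t - t * cos t.

Lemma sin_le_id t : 0 <= t -> sin t <= t.
Proof.
move=> t0.
have [|c _] := @MVT_segment R (@sin R) (@cos R) 0 t t0 (fun x _ => is_derive_sin x).
  exact/continuous_subspaceT/continuous_sin.
by rewrite sin0 !subr0 => ->; rewrite ler_piMl// cos_le1.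
Qed.

(** Multiplying by sin t linearises the Riccati equation: W' = (P/t) W plus a source proportional to
    the residual. *)
Lemma is_derive_cot_defect N t : 0 < t ->
  is_derive t 1 (cot_defect N)
    ((cot_poly R N).[t ^+ 2] / t * cot_defect N t +
     (cot_residual R N).[t ^+ 2] / t * sin t).
Proof.
move=> t0.
have dP : is_derive t 1 (horner (cot_poly R N) \o (fun x : R => x ^+ 2))
   ((2 * t) * (cot_poly R N)^`().[t ^+ 2]).
  apply: is_derive_eq.
  by rewrite /GRing.scale/=; ring.
rewrite (_ : cot_defect N = (cst 1 - (horner (cot_poly R N) \o
  (fun x : R => x ^+ 2))) * (@sin R) - id * (@cos R)); last first.
  by apply/funext => x.
apply: is_derive_eq.
rewrite /GRing.scale/= !fctE/= /cot_defect /cot_residual.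
rewrite !(hornerD, hornerN, hornerZ, hornerM, hornerX, horner_exp).
by field; rewrite gt_eqF.
Qed.

(** A crude bound 5 + 2, enough to make the cross term of W with the residual small in the Gronwall
    step. *)
Lemma cot_defect_norm_le N t : 0 <= t <= 2 -> `|cot_defect N t| <= 7.
Proof.
move=> /andP[t0 t2]; have s4 : 0 <= t ^+ 2 <= 4 by apply/andP; split; nra.
have p0 := horner_cot_poly_ge0 R N (t ^+ 2) (proj1 (andP s4)).
have p1 := horner_cot_poly_le R N (t ^+ 2) s4.
apply: (le_trans (ler_normB _ _)); rewrite !normrM.
have : `|sin t| <= 1 by rewrite ler_norml sin_geN1 sin_le1.
have : `|cos t| <= 1 by rewrite ler_norml cos_geN1 cos_le1.
have : `|1 - (cot_poly R N).[t ^+ 2]| <= 5.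
  by rewrite ler_norml; apply/andP; split; lra.
rewrite (ger0_norm t0).
have := normr_ge0 (sin t); have := normr_ge0 (cos t).
have := normr_ge0 (1 - (cot_poly R N).[t ^+ 2]).
nra.
Qed.

(* Gronwall: [expR (- 4 t) * W ^ 2] has small derivative because
   [P (t ^ 2) / t <= t <= 2] on the interval. *)
Lemma cot_defect_sqr_le N t : (0 < N)%N -> 0 < t <= 2 ->
  cot_defect N t ^+ 2 <= expR 8 * 2800 * (4 / 5) ^+ N.
Proof.
move=> N0 /andP[t0 t2].
pose W := cot_defect N.
pose dW (x : R) := (cot_poly R N).[x ^+ 2] / x * W x +
     (cot_residual R N).[x ^+ 2] / x * sin x.
pose F : R -> R := (expR \o (fun x : R => (- 4) * x)) * (W ^+ 2).
pose dF (x : R) := expR (- 4 * x) * (2 * W x * dW x - 4 * W x ^+ 2).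
have dFE (x : R) : 0 < x -> is_derive x 1 F (dF x).
  move=> x0; have dWx : is_derive x 1 W (dW x) by exact: is_derive_cot_defect.
  rewrite /F; apply: is_derive_eq.
  rewrite /GRing.scale/= /dF /= !fctE /=; ring.
have cW : continuous W.
  move=> x; rewrite /W /cot_defect; apply: cvgB; apply: cvgM.
  - apply: cvgB; first exact: cvg_cst.
    apply: (@continuous_comp _ _ _ (fun x : R => x ^+ 2) (horner (cot_poly R N))).
      exact: exprn_continuous.
    exact: continuous_horner.
  - exact: continuous_sin.
  - exact: cvg_id.
  - exact: continuous_cos.
have cF : continuous F.
  move=> x; rewrite /F; apply: cvgM; last first.
    by rewrite expr2; apply: cvgM; exact: cW.
  apply: continuous_comp; last exact: continuous_expR.
  by apply: cvgM; [exact: cvg_cst|exact: cvg_id].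
have [||c] := @MVT R F dF 0 t t0.
- by move=> x; rewrite in_itv/= => /andP[x0 _]; exact: dFE.
- exact/continuous_subspaceT/cF.
rewrite in_itv/= => /andP[c0 ct].
have FE x : F x = expR (- 4 * x) * W x ^+ 2.
  by rewrite /F !fctE.
have -> : F 0 = 0.
  by rewrite FE /W /cot_defect sin0 !mulr0 mul0r subr0 expr2 !mulr0.
rewrite !subr0 => Ft.
set eps : R := (4 / 5) ^+ N.
have eps0 : 0 <= eps by rewrite exprn_ge0.
have c2 : 0 <= c <= 2 by apply/andP; split; lra.
have s4 : 0 <= c ^+ 2 <= 4 by apply/andP; split; nra.
have Wc := cot_defect_norm_le N c c2.
have p1 := horner_cot_poly_le R N (c ^+ 2) s4.
have r0 := cot_residual_ge0 R N (c ^+ 2) N0 (proj1 (andP s4)).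
have r1 := cot_residual_le R N (c ^+ 2) N0 s4.
have pc : (cot_poly R N).[c ^+ 2] / c <= 2.
  by rewrite ler_pdivrMr//; nra.
have sc0 : 0 <= sin c.
  by apply: sin_ge0_pi; rewrite (ltW c0)/=; have := pi_ge2 R; lra.
have sc1 : sin c / c <= 1 by rewrite ler_pdivrMr// mul1r sin_le_id// ltW.
have sc2 : 0 <= sin c / c by rewrite divr_ge0// ltW.
have rc : `|(cot_residual R N).[c ^+ 2] / c * sin c| <= 100 * eps.
  rewrite mulrAC -mulrA ger0_norm; last by rewrite mulr_ge0.
  exact: le_trans (ler_piMr r0 sc1) r1.
(* Since P/c <= 2, the quadratic part 2 (P/c - 2) W^2 is nonpositive; what is left is twice the
   product of the bounds 7 and 100 eps. *)
have Xc : 2 * W c * dW c - 4 * W c ^+ 2 <= 1400 * eps.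
  have : W c * ((cot_residual R N).[c ^+ 2] / c * sin c) <= 700 * eps.
    rewrite (le_trans (ler_norm _))// normrM.
    by rewrite (le_trans (ler_pM (normr_ge0 _) (normr_ge0 _) Wc rc))//; lra.
  rewrite /dW; move: pc (sqr_ge0 (W c)).
  set p := _ / c; set q := _ * sin c; move: p q (W c) => p q w p2 w0 wq.
  have -> : 2 * w * (p * w + q) - 4 * w ^+ 2 = 2 * ((p - 2) * w ^+ 2) + 2 * (w * q).
    by ring.
  have : (p - 2) * w ^+ 2 <= 0 by rewrite mulr_le0_ge0// subr_le0.
  lra.
have M0 : 0 <= 1400 * eps by lra.
have e1 : expR (- 4 * c) <= 1.
  by rewrite -[leRHS]expR0 ler_expR mulNr oppr_le0 mulr_ge0// ltW.
have dFc : dF c <= 1400 * eps.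
  exact: le_trans (ler_wpM2l (expR_ge0 _) Xc) (ler_piMl M0 e1).
have : F t <= 2800 * eps.
  rewrite Ft (_ : 2800 * eps = 1400 * eps * 2); last by lra.
  exact: le_trans (ler_wpM2r (ltW t0) dFc) (ler_wpM2l M0 t2).
rewrite FE -/(W t) => h.
(* Removing the weight costs expR (4 t) <= expR 8, as t <= 2. *)
have -> : W t ^+ 2 = expR (4 * t) * (expR (- 4 * t) * W t ^+ 2).
  by rewrite mulrA -expRD mulNr subrr expR0 mul1r.
rewrite -!mulrA; apply: ler_pM; rewrite ?expR_ge0//.
  by rewrite mulr_ge0 ?expR_ge0 ?sqr_ge0.
by rewrite ler_expR; lra.
Qed.

Lemma cvg_cot_poly t : 0 < t <= pi / 2 ->
  (cot_poly R N).[t ^+ 2] @[N --> \oo] --> 1 - t * cot t.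
Proof.
move=> /andP[t0 tpi].
have t2 : 0 < t <= 2 by rewrite t0 (le_trans tpi)// ltW// pihalf_lt2.
have st : 0 < sin t by apply: sin_gt0_pi; rewrite t0/=; have := pi_gt0 R; lra.
have q1 : `|4 / 5 : R| < 1 by rewrite ger0_norm; lra.
have W2 : cot_defect N t ^+ 2 @[N --> \oo] --> 0.
  apply: (@squeeze_cvgr _ _ _ _ (cst 0) (geometric (expR 8 * 2800) (4 / 5))).
  - near=> N; rewrite sqr_ge0/= cot_defect_sqr_le//.
    by near: N; exact: nbhs_infty_gt.
  - exact: cvg_cst.
  - exact: cvg_geometric.
have W0 : cot_defect N t @[N --> \oo] --> 0.
  apply: norm_cvg0; under eq_cvg => N do rewrite -sqrtr_sqr.
  by have := cvg_comp _ _ W2 (@sqrt_continuous R 0); rewrite sqrtr0.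
rewrite (_ : 1 - t * cot t = 1 - (0 + t * cos t) / sin t); last first.
  by rewrite add0r /cot mulrA.
rewrite (_ : (fun N => _) =
    (fun N => 1 - (cot_defect N t + t * cos t) / sin t)); last first.
  by apply/funext => N; rewrite /cot_defect; field; rewrite gt_eqF.
apply: cvgB; first exact: cvg_cst.
apply: cvgM; last exact: cvg_cst.
by apply: cvgD => //; exact: cvg_cst.
Unshelve. all: by end_near. Qed.

End CotLimit.

(** * Values of p_n at powers of 1/4 and the series of g_n *)

Section Weights.
Variable R : realType.
Implicit Types (n m N k : nat) (s t : R).

Lemma exp4_gt1 k : (0 < k)%N -> 1 < 4 ^+ k :> R.
Proof. by move=> k0; rewrite exprn_egt1 ?ltr1n// -lt0n. Qed.

Lemma subr_exp4_gt0 k : (0 < k)%N -> 0 < 4 ^+ k - 1 :> R.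
Proof. by move=> k0; rewrite subr_gt0 exp4_gt1. Qed.

Lemma p_poly_recr n :
  p_poly R n.+1 = p_poly R n * ((4 ^+ n.+1 - 1)^-1 *: (4 ^+ n.+1 *: 'X - 1)).
Proof. by rewrite /p_poly big_nat_recr. Qed.

Lemma size_p_poly n : (size (p_poly R n) <= n.+1)%N.
Proof.
elim: n => [|n IH]; first by rewrite /p_poly big_geq// size_poly1.
rewrite p_poly_recr (leq_trans (size_polyMleq _ _))//.
apply: (@leq_trans (n.+1 + 2).-1); last by rewrite addn2.
rewrite -!subn1 leq_sub2r// leq_add//.
rewrite (leq_trans (size_scale_leq _ _))// (leq_trans (size_polyD _ _))//.
rewrite size_polyN size_poly1 geq_max (leq_trans (size_scale_leq _ _))//.
by rewrite size_polyX.
Qed.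

Lemma horner_p_poly n y :
  (p_poly R n).[y] = \sum_(0 <= k < n.+1) A_coef R n k * y ^+ k.
Proof. by rewrite (horner_coef_wide _ (size_p_poly n)) big_mkord. Qed.

Lemma horner_p_poly_prod n y :
  (p_poly R n).[y] =
  \prod_(1 <= k < n.+1) ((4 ^+ k - 1)^-1 * (4 ^+ k * y - 1)).
Proof.
rewrite /p_poly horner_prod; apply: eq_bigr => k _.
by rewrite !(hornerZ, hornerD, hornerN, hornerX, hornerC).
Qed.

Lemma horner_p_poly1 n : (p_poly R n).[1] = 1.
Proof.
rewrite horner_p_poly_prod big_nat_cond big1// => k /andP[/andP[k0 _] _].
by rewrite mulr1 mulVf// gt_eqF// subr_exp4_gt0.
Qed.

(* [p_n] vanishes at [4^-m] for [1 <= m <= n], which kills the terms of degree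
   at most [2 n] in [g_n]. *)
Definition weight n m : R :=
  \prod_(1 <= k < n.+1) ((4 ^+ k - 1)^-1 * (1 - 4 ^+ k / 4 ^+ m)).

(** The limit of [weight n m] as [m] grows. *)
Definition weight_bound n : R := \prod_(1 <= k < n.+1) (4 ^+ k - 1)^-1.

Lemma horner_p_poly_expV n m : (p_poly R n).[4 ^- m] = (-1) ^+ n * weight n m.
Proof.
rewrite horner_p_poly_prod /weight; elim: n => [|n IH].
  by rewrite !big_geq// mul1r.
rewrite big_nat_recr//= IH [in RHS]big_nat_recr//= [(-1) ^+ n.+1]exprS.
by move: (4 ^+ n.+1 - 1)^-1 (4 ^+ n.+1 / _) => a b; ring.
Qed.

Lemma weight_eq0 n m : (0 < m <= n)%N -> weight n m = 0.
Proof.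
move=> /andP[m0 mn]; apply/eqP; rewrite /weight prodf_seq_eq0.
apply/hasP; exists m; first by rewrite mem_index_iota m0.
by rewrite divff ?subrr ?mulr0 ?eqxx ?expf_neq0.
Qed.

Lemma weight_factor_gt0 m k : (k < m)%N -> 0 < 1 - 4 ^+ k / 4 ^+ m :> R.
Proof.
move=> km; rewrite subr_gt0 ltr_pdivrMr ?exprn_gt0// mul1r ltr_eXn2l//.
by rewrite ltr1n.
Qed.

Lemma weight_gt0 n m : (n < m)%N -> 0 < weight n m.
Proof.
move=> nm; rewrite /weight big_nat_cond prodr_gt0// => k.
move=> /andP[/andP[k0 kn] _].
rewrite mulr_gt0 ?invr_gt0 ?subr_exp4_gt0// weight_factor_gt0//.
exact: leq_ltn_trans nm.
Qed.

Lemma weight_ge0 n m : (0 < m)%N -> 0 <= weight n m.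
Proof.
move=> m0; case: (leqP m n) => mn; first by rewrite weight_eq0 ?m0.
exact/ltW/weight_gt0.
Qed.

Lemma weight_bound_gt0 n : 0 < weight_bound n.
Proof.
rewrite /weight_bound big_nat_cond prodr_gt0// => k /andP[/andP[k0 kn] _].
by rewrite invr_gt0 subr_exp4_gt0.
Qed.

Lemma weight_le n m : (0 < m)%N -> weight n m <= weight_bound n.
Proof.
move=> m0; case: (leqP m n) => mn.
  by rewrite weight_eq0 ?m0// ltW// weight_bound_gt0.
rewrite /weight /weight_bound big_nat_cond [leRHS]big_nat_cond.
apply: ler_prod => k /andP[/andP[k0 kn] _].
have i0 : 0 < (4 ^+ k - 1)^-1 :> R by rewrite invr_gt0 subr_exp4_gt0.
have f0 := weight_factor_gt0 m k (leq_ltn_trans (kn : (k <= n)%N) mn).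
by rewrite mulr_ge0 ?(ltW i0) ?(ltW f0)//= ler_piMr ?(ltW i0)// gerBl divr_ge0.
Qed.

(** The base case is 2/9 < 1/4, and each further factor is at most 1/4. The 2/3 is the bound on 1 -
    (pi/2)^2 / 3 used in [tail_pihalf_lt]. *)
Lemma weight_bound_lt n : (0 < n)%N -> weight_bound n * (2 / 3) < 4 ^- n.
Proof.
case: n => // n _; elim: n => [|n IH].
  rewrite /weight_bound big_nat1 !expr1.
  by rewrite (_ : 4 - 1 = 3 :> R); lra.
rewrite /weight_bound big_nat_recr//= -/(weight_bound _).
rewrite exprS invfM mulrAC mulrC.
have p4 : 1 <= 4 ^+ n :> R by rewrite exprn_ege1// ler1n.
have i0 : (4 ^+ n.+2 - 1)^-1 <= 4^-1 :> R.
  by rewrite lef_pV2 ?posrE ?subr_exp4_gt0// !exprS; lra.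
apply: (le_lt_trans (ler_wpM2r _ i0)).
  by rewrite mulr_ge0// ltW// weight_bound_gt0.
by rewrite ltr_pM2l.
Qed.

Definition tail_sum n N s : R :=
  \sum_(m < N.+1) cot_coef R m * weight n m * s ^+ m.

Definition tail n t : R := (-1) ^+ n * (1 - g_formula n t).

Lemma g_formula_tail n t : g_formula n t = 1 - (-1) ^+ n * tail n t.
Proof. by rewrite /tail mulrA -exprMn mulrNN mulr1 expr1n mul1r subKr. Qed.

(** Expanding p_n(4^-m) = sum_k A_k 4^(-km) and exchanging sums regroups the series at the points s
    / 4^k, the squares of the angles t / 2^k when s = t^2. *)
Lemma tail_sumE n N s : tail_sum n N s =
  (-1) ^+ n * \sum_(0 <= k < n.+1) A_coef R n k * (cot_poly R N).[s / 4 ^+ k].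
Proof.
transitivity ((-1) ^+ n *
    \sum_(m < N.+1) cot_coef R m * s ^+ m * (p_poly R n).[4 ^- m]).
  rewrite /tail_sum mulr_sumr; apply: eq_bigr => m _.
  rewrite horner_p_poly_expV mulrCA [_ * (_ * weight n m)]mulrA.
  by rewrite -exprMn mulrNN mulr1 expr1n mul1r mulrAC.
congr (_ * _); under eq_bigr do rewrite horner_p_poly mulr_sumr.
rewrite exchange_big /=; apply: eq_bigr => k _.
rewrite horner_cot_poly mulr_sumr; apply: eq_bigr => m _.
by rewrite expr_div_n !exprVn -!exprM mulnC; ring.
Qed.

Lemma cvg_tail n t : 0 < t <= pi / 2 ->
  tail_sum n N (t ^+ 2) @[N --> \oo] --> tail n t.
Proof.
move=> /andP[t0 tpi].
have -> : tail n t = (-1) ^+ n * \sum_(0 <= k < n.+1)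
    A_coef R n k * (1 - t / 2 ^+ k * cot (t / 2 ^+ k)).
  (* The leading 1 is p_n(1), the sum of the A_k, so it distributes over the cotangent terms. *)
  congr (_ * _); rewrite -[X in X - _ = _](horner_p_poly1 n) horner_p_poly.
  rewrite /g_formula mulr_sumr -sumrB; apply: eq_bigr => k _.
  by rewrite expr1n; ring.
under eq_cvg => N do rewrite tail_sumE.
apply: cvgM; first exact: cvg_cst.
apply: cvg_big => [|k _]; first exact: add_continuous.
apply: cvgM; first exact: cvg_cst.
rewrite (_ : t ^+ 2 / 4 ^+ k = (t / 2 ^+ k) ^+ 2); last first.
  by rewrite expr_div_n -exprM mulnC exprM (_ : 2 ^+ 2 = 4 :> R)//; lra.
apply: cvg_cot_poly; rewrite divr_gt0 ?exprn_gt0//=.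
rewrite (le_trans _ tpi)// ler_pdivrMr ?exprn_gt0// ler_peMr ?(ltW t0)//.
by rewrite exprn_ege1// ler1n.
Qed.

End Weights.

(** * Monotonicity and size of (-1)^n (1 - g_n) *)

Section Tail.
Variable R : realType.
Implicit Types (n m N k : nat) (s t : R).

(** Every term is nondecreasing in s. Keeping only m = n+1, the first nonzero one, gives a gap
    independent of [N], so strictness survives the limit. *)
Lemma tail_sum_gap n N s1 s2 : 0 <= s1 <= s2 -> (n < N)%N ->
  cot_coef R n.+1 * weight R n n.+1 * (s2 ^+ n.+1 - s1 ^+ n.+1) <=
  tail_sum R n N s2 - tail_sum R n N s1.
Proof.
move=> /andP[s10 s12] nN; rewrite /tail_sum -sumrB.
have hN : (n.+1 < N.+1)%N by [].
rewrite (bigD1 (Ordinal hN)) //= -mulrBr lerDl sumr_ge0// => -[[|m] hm] _ /=.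
  by rewrite cot_coef0 !mul0r subrr.
rewrite -mulrBr mulr_ge0 ?mulr_ge0 ?cot_coef_ge0 ?weight_ge0//.
by rewrite subr_ge0 lerXn2r ?nnegrE// (le_trans s10).
Qed.

(** As [weight n 1] vanishes, the term a_1 s = s / 3 drops out before the other weights are replaced
    by their bound. *)
Lemma tail_sum_le n N s : (0 < n)%N -> (0 < N)%N -> 0 <= s ->
  tail_sum R n N s <= weight_bound R n * ((cot_poly R N).[s] - s / 3).
Proof.
move=> n0; case: N => // N _ s0; rewrite horner_cot_poly /tail_sum.
rewrite !big_ord_recl /= /bump /= addn0 cot_coef0 cot_coef1 (weight_eq0 _ n 1) ?n0//.
rewrite !mul0r mulr0 mul0r !add0r expr1 [X in X - _]addrC [s / 3]mulrC addrK.
rewrite mulr_sumr; apply: ler_sum => i _.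
rewrite -mulrA mulrCA ler_wpM2r ?weight_le//.
by rewrite mulr_ge0 ?exprn_ge0 ?cot_coef_ge0.
Qed.

Lemma tail_lt n t1 t2 : 0 < t1 -> t1 < t2 -> t2 <= pi / 2 ->
  tail R n t1 < tail R n t2.
Proof.
move=> t10 t12 t2pi; have t20 := lt_trans t10 t12.
have c1 : tail_sum R n N (t1 ^+ 2) @[N --> \oo] --> tail R n t1.
  by apply: cvg_tail; rewrite t10 (le_trans (ltW t12)).
have c2 : tail_sum R n N (t2 ^+ 2) @[N --> \oo] --> tail R n t2.
  by apply: cvg_tail; rewrite t20.
rewrite -subr_gt0.
apply: (@lt_le_trans _ _ (cot_coef R n.+1 * weight R n n.+1 *
    ((t2 ^+ 2) ^+ n.+1 - (t1 ^+ 2) ^+ n.+1))).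
  rewrite !mulr_gt0 ?cot_coef_gt0 ?weight_gt0// subr_gt0.
  by rewrite ltrXn2r// ?nnegrE ?sqr_ge0// ltrXn2r// ?nnegrE ltW.
apply: (cvgr_to_ge (cvgB c2 c1)); near=> N.
apply: tail_sum_gap; last by near: N; exact: nbhs_infty_gt.
by rewrite sqr_ge0/= lerXn2r ?nnegrE// ltW.
Unshelve. all: by end_near. Qed.

Lemma tail_gt0 n t : 0 < t <= pi / 2 -> 0 < tail R n t.
Proof.
move=> /andP[t0 tpi].
apply: (@lt_le_trans _ _ (cot_coef R n.+1 * weight R n n.+1 *
    ((t ^+ 2) ^+ n.+1 - 0 ^+ n.+1))).
  by rewrite expr0n/= subr0 !mulr_gt0 ?cot_coef_gt0 ?weight_gt0 ?exprn_gt0.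
have c : tail_sum R n N (t ^+ 2) @[N --> \oo] --> tail R n t.
  by apply: cvg_tail; rewrite t0.
apply: (cvgr_to_ge c); near=> N.
rewrite (le_trans (tail_sum_gap n N 0 (t ^+ 2) _ _)) ?lexx ?sqr_ge0//.
  by near: N; exact: nbhs_infty_gt.
rewrite gerBl /tail_sum sumr_ge0// => -[[|m] hm] _ /=.
  by rewrite cot_coef0 !mul0r.
by rewrite expr0n mulr0.
Unshelve. all: by end_near. Qed.

Lemma tail_le n t : (0 < n)%N -> 0 < t <= pi / 2 ->
  tail R n t <= weight_bound R n * (1 - t * cot t - t ^+ 2 / 3).
Proof.
move=> n0 tpi.
have c : (tail_sum R n N (t ^+ 2) : R) @[N --> \oo] --> tail R n t.
  exact: cvg_tail.
have c' : weight_bound R n * ((cot_poly R N).[t ^+ 2] - t ^+ 2 / 3) @[N --> \oo]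
    --> weight_bound R n * (1 - t * cot t - t ^+ 2 / 3).
  apply: cvgM; first exact: cvg_cst.
  by apply: cvgB; [exact: cvg_cot_poly|exact: cvg_cst].
apply: (ler_cvg_to c c'); near=> N.
by apply: tail_sum_le; rewrite ?sqr_ge0//; near: N; exact: nbhs_infty_gt.
Unshelve. all: by end_near. Qed.

(** Passes P(s) <= s to the limit; it serves the squeeze that gives g_n -> 1 at 0. *)
Lemma tail_le_sqr n t : (0 < n)%N -> 0 < t <= pi / 2 ->
  tail R n t <= weight_bound R n * t ^+ 2.
Proof.
move=> n0 tpi; have /andP[t0 t2] := tpi.
apply: (le_trans (tail_le _ _ n0 tpi)).
rewrite ler_wpM2l ?(ltW (weight_bound_gt0 _ _))//.
apply: (@le_trans _ _ (1 - t * cot t)).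
  by rewrite gerBl divr_ge0 ?sqr_ge0.
apply: (cvgr_to_le (cvg_cot_poly _ _ tpi)); near=> N.
apply: horner_cot_poly_le; rewrite sqr_ge0/=.
have h : t <= 2 by rewrite (le_trans t2)// ltW// pihalf_lt2.
have := ltW t0; nra.
Unshelve. all: by end_near. Qed.

(** Since cot (pi/2) = 0 and (pi/2)^2 >= 1, the factor in [tail_le] is at most 1 - 1/3. *)
Lemma tail_pihalf_lt n : (0 < n)%N -> tail R n (pi / 2) < 4 ^- n.
Proof.
move=> n0; have p1 := pihalf_ge1 R.
apply: le_lt_trans (weight_bound_lt R n n0).
apply: (le_trans (tail_le _ _ n0 _)); first by rewrite lexx andbT; lra.
rewrite ler_wpM2l ?(ltW (weight_bound_gt0 _ _))//.
rewrite /cot cos_pihalf mul0r mulr0 subr0.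
have : 1 <= (pi / 2 : R) ^+ 2 by rewrite exprn_ege1.
lra.
Qed.

Lemma cvg_g_formula0 n : (0 < n)%N -> g_formula n t @[t --> (0 : R)^'+] --> (1 : R).
Proof.
move=> n0.
have tail0 : tail R n t @[t --> (0 : R)^'+] --> 0.
  apply: (@squeeze_cvgr _ _ _ _ (cst 0) (fun t => weight_bound R n * t ^+ 2)).
  - near=> t.
    have tpi : 0 < t <= pi / 2.
      apply/andP; split; first by near: t; exact: nbhs_right_gt.
      by near: t; apply: nbhs_right_le; have := pihalf_ge1 R; lra.
    by rewrite (ltW (tail_gt0 _ _ tpi))/= tail_le_sqr.
  - exact: cvg_cst.
  - rewrite -[X in _ --> X](mulr0 (weight_bound R n)).
    apply: cvgM; first exact: cvg_cst.
    apply: cvg_at_right_filter.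
    have : (t ^+ 2) @[t --> (0 : R)] --> (0 : R) ^+ 2 by exact: exprn_continuous.
    by rewrite expr0n.
rewrite (_ : g_formula n = fun t => 1 - (-1) ^+ n * tail R n t); last first.
  by apply/funext => t; exact: g_formula_tail.
rewrite -[X in _ --> X]subr0 -[X in _ --> _ - X](mulr0 ((-1) ^+ n)).
apply: cvgB; first exact: cvg_cst.
by apply: cvgM => //; exact: cvg_cst.
Unshelve. all: by end_near. Qed.

End Tail.

(** * Elementary symmetric form of the A_k, and L_j as half-angle cotangents *)

Section Algebra.
Variable R : realType.

Lemma elem_symE n j (y : 'I_n -> R) :
  elem_sym j y = \sum_(h : {set 'I_n} | #|h| == j) \prod_(i in h) y i.
Proof.
rewrite /elem_sym /mpoly.mesym rmorph_sum /=; apply: eq_bigr => h _.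
by rewrite rmorph_prod /=; apply: eq_bigr => i _; rewrite mpoly.mevalXU.
Qed.

(** Expand over the set [h] of factors that contribute their X term: only [#|h| = j] reaches X^j,
    and each of the other n - j factors contributes -1. *)
Lemma coef_prod_scaleX_sub1 n j (c : R) (y : 'I_n -> R) : (j <= n)%N ->
  (\prod_(i < n) ((c * y i) *: 'X - 1))`_j =
  (-1) ^+ (n - j) * c ^+ j * elem_sym j y.
Proof.
move=> jn; rewrite bigA_distr coef_sum elem_symE mulr_sumr [RHS]big_mkcond /=.
apply: eq_bigr => h _.
rewrite big_if /= scaler_prod !prodr_const /= -(rmorphN1 polyC).
rewrite -rmorphXn -scalerAl coefZ coefMC coefXn eq_sym.
case: eqP => [hj|_]; last by rewrite mul0r mulr0.
rewrite mul1r big_split /= prodr_const hj.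
have -> : #|[pred i | i \notin h]| = (n - j)%N.
  by rewrite -hj -[X in (X - _)%N](card_ord n) -(cardC h) addKn.
by rewrite mulrC mulrA.
Qed.

Lemma A_coef_elem_sym n j : (j <= n)%N ->
  A_coef R n j * \prod_(1 <= k < n.+1) (4 ^+ k - 1) =
  (-1) ^+ (n - j) * 4 ^+ j * elem_sym j (fun i : 'I_n => 4 ^+ i).
Proof.
move=> jn; rewrite -coef_prod_scaleX_sub1// /A_coef -coefMC.
congr (_ `_ j); rewrite /p_poly rmorph_prod -big_split /=.
(* The index shift writes 4^k as 4 * 4^(k-1), which fixes c = 4 and the variables 1, 4, ...,
   4^(n-1). *)
rewrite big_add1 /= big_mkord.
rewrite (eq_bigr (fun i : 'I_n => (4 * 4 ^+ i) *: 'X - 1)) => [//|i _].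
rewrite mulrC mul_polyC scalerA divff ?scale1r ?exprS//.
by rewrite gt_eqF// -exprS subr_exp4_gt0.
Qed.

Lemma cot_half (t : R) : 0 < t < pi ->
  cot (t / 2) = cot t + (sin t)^-1.
Proof.
move=> /andP[t0 tpi].
have s0 : 0 < sin (t / 2) by apply: sin_gt0_pi; apply/andP; split; lra.
have c0 : 0 < cos (t / 2) by apply: cos_gt0_pihalf; apply/andP; split; lra.
have e : t = t / 2 + t / 2 by lra.
rewrite /cot [in RHS]e sinD cosD.
have := cos2Dsin2 (t / 2).
move: (sin (t / 2)) (cos (t / 2)) s0 c0 => s c s0 c0 h.
rewrite -[X in _ + X]mul1r -[X in _ + X / _]h.
by field; rewrite !gt_eqF// addr_gt0// mulr_gt0.
Qed.

Lemma atan_gt0 (x : R) : 0 < x -> 0 < atan x.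
Proof. by move=> x0; rewrite -[ltLHS]atan0; exact: lt_atan. Qed.

(** With t = atan x / 2^j, the square root of x^2 + (x cot t)^2 is x / sin t, so the recursion is
    the half-angle formula [cot_half]. *)
Lemma L_fun_atan j (x : R) : 0 < x ->
  L_fun j x = x * cot (atan x / 2 ^+ j).
Proof.
move=> x0.
have ax0 := atan_gt0 _ x0.
have axpi := atan_ltpi2 x.
have pi0 := pi_gt0 R.
elim: j => [|j IH] /=.
  have st : 0 < sin (atan x) by apply: sin_gt0_pihalf; rewrite ax0.
  have ct : 0 < cos (atan x) by apply: cos_gt0_pihalf; rewrite axpi andbT; lra.
  by rewrite expr0 divr1 -{1}(atanK x) /tan /cot; field; rewrite !gt_eqF.
set t := atan x / 2 ^+ j in IH *.
have t0 : 0 < t by rewrite divr_gt0 ?exprn_gt0.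
have tpi : t < pi.
  apply: (@le_lt_trans _ _ (atan x)); last by lra.
  rewrite ler_pdivrMr ?exprn_gt0// ler_peMr ?(ltW ax0)//.
  by rewrite exprn_ege1// ler1n.
have st : 0 < sin t by apply: sin_gt0_pi; rewrite t0.
have -> : atan x / 2 ^+ j.+1 = t / 2 by rewrite /t exprSr invfM mulrA.
rewrite cot_half ?t0// mulrDr IH; congr (_ + _).
have -> : x ^+ 2 + (x * cot t) ^+ 2 = (x / sin t) ^+ 2.
  rewrite expr_div_n -[X in _ = X / _]mulr1 -(cos2Dsin2 t) /cot.
  by field; rewrite gt_eqF.
by rewrite sqrtr_sqr ger0_norm// divr_ge0// ltW.
Qed.

Lemma a_fun_atan n (x : R) : 0 < x ->
  a_fun n x = atan x / g_formula n (atan x).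
Proof.
move=> x0.
have ax0 := atan_gt0 _ x0.
pose D : R := \prod_(1 <= k < n.+1) (4 ^+ k - 1).
have D0 : 0 < D.
  rewrite /D big_nat_cond prodr_gt0// => k /andP[/andP[k0 _] _].
  exact: subr_exp4_gt0.
rewrite /a_fun /g_formula -/D.
set S := \sum_(0 <= k < n.+1) (A_coef R n k / _ * _).
have -> : \sum_(0 <= j < n.+1) ((-1) ^+ (n - j) * L_fun j x * 2 ^+ j *
     elem_sym j (fun i : 'I_n => 4 ^+ i)) = D * x * S.
  rewrite /S mulr_sumr big_nat_cond [RHS]big_nat_cond.
  apply: eq_bigr => j /andP[/andP[_ jn] _].
  rewrite L_fun_atan//.
  have -> : D * x * (A_coef R n j / 2 ^+ j * cot (atan x / 2 ^+ j)) =
     A_coef R n j * D * x / 2 ^+ j * cot (atan x / 2 ^+ j) by ring.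
  rewrite A_coef_elem_sym// (_ : 4 = 2 * 2 :> R); last by lra.
  rewrite exprMn; field; by rewrite expf_neq0.
(* If [S] is 0, both quotients have denominator 0 and equal 0 by convention. *)
have [->|S0] := eqVneq S 0; first by rewrite !mulr0 invr0 !mulr0.
by field; rewrite S0 !gt_eqF.
Qed.

End Algebra.

(** * The arctangent bounds, by parity of n *)

Theorem mainTheorem2 (R : realType) (n : nat) (n_gt0 : (0 < n)%N) :
  [/\ g_formula n t @[t --> (0 : R)^'+] --> (1 : R),
      forall x : R, 0 < x ->
        K_low R n * a_fun n x < atan x < K_high R n * a_fun n x
    & K_high R n - K_low R n < 4 ^- n].
Proof.
have g0 : g_fun n (0 : R) = 1.
  by rewrite /g_fun eqxx; apply/cvg_lim => //; exact: cvg_g_formula0.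
have pih0 : 0 < pi / 2 :> R by rewrite divr_gt0// pi_gt0.
pose tau := tail R n (pi / 2).
have gpi : g_fun n (pi / 2 : R) = 1 - (-1) ^+ n * tau.
  by rewrite /g_fun gt_eqF// g_formula_tail.
have tau0 : 0 < tau by apply: tail_gt0; rewrite pih0 lexx.
have tau4 : tau < 4 ^- n by exact: tail_pihalf_lt.
(* Keeps g_n positive for even [n], where it equals 1 minus a tail below [tau]. *)
have tau1 : tau < 1.
  by rewrite (lt_trans tau4)// invf_lt1 ?exprn_gt0// exp4_gt1.
split; first exact: cvg_g_formula0.
- move=> x x0.
  have ax0 := atan_gt0 _ _ x0.
  have tx0 : 0 < tail R n (atan x).
    by apply: tail_gt0; rewrite ax0 ltW// atan_ltpi2.
  have txtau : tail R n (atan x) < tau.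
    by apply: tail_lt => //; exact: atan_ltpi2.
  rewrite a_fun_atan// g_formula_tail /K_low /K_high g0 gpi.
  move: tx0 txtau ax0; move: (tail R n (atan x)) => e.
  move: (atan x) => th e0 etau th0.
  (* For odd [n], g_n rises from 1 to 1 + tau; for even [n] it falls from 1 to 1 - tau. Parity thus
     decides which endpoint gives the minimum. *)
  rewrite -signr_odd; case: (odd n); rewrite /= ?expr1 ?expr0 ?mul1r ?mulN1r ?opprK.
  + have d0 : 0 < 1 + e by lra.
    rewrite min_l ?max_r; [|lra|lra].
    rewrite mul1r ltr_pdivrMr// mulrA ltr_pdivlMr//.
    by apply/andP; split; nra.
  + have d0 : 0 < 1 - e by lra.
    rewrite min_r ?max_l; [|lra|lra].
    rewrite mul1r mulrA ltr_pdivrMr// ltr_pdivlMr//.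
    by apply/andP; split; nra.
- rewrite /K_low /K_high g0 gpi -signr_odd.
  case: (odd n); rewrite /= ?expr1 ?expr0 ?mul1r ?mulN1r ?opprK.
  + by rewrite min_l ?max_r; lra.
  + by rewrite min_r ?max_l; lra.
Qed.
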